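(* The infinite product $$\Lambda(x)=\prod_{n=1}^{\infty}\prod_{k=1}^{n}k^{\frac{(-1)^{n+k}}{(n-k)!\,(k+n-1)!}\cdot\frac{2k-1}{2n-1}\cdot\frac{\Gamma(x+n)}{\Gamma(x+1-n)}}$$ converges for every real $x$, and the resulting function interpolates the factorial at the positive integers and the reciprocal factorial at the negative integers: for every integer $N\ge 1$, $$\Lambda(N)=N!\qquad\text{and}\qquad \Lambda(-N)=\frac{1}{N!}.$$
   Context: For integer $n\ge 1$, the quotient $\frac{\Gamma(x+n)}{\Gamma(x+1-n)}$ is understood as the polynomial $(x-n+1)(x-n+2)\cdots(x+n-1)=x\prod_{j=1}^{n-1}(x^2-j^2)$, for all real $x$ (including integers). The infinite product over $n$ is understood as the limit of the partial products $\prod_{n=1}^{M}\prod_{k=1}^{n}$ as $M\to\infty$; equivalently, convergence means convergence of the series over $n$ of logarithms of the inner products. *)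

(* Defs.v *)
From mathcomp Require Import all_boot all_order all_algebra.
From mathcomp Require Import all_classical all_reals all_analysis.
From mathcomp Require Import ring.
Import Order.TTheory GRing.Theory Num.Theory.
Import numFieldNormedType.Exports.

Set Implicit Arguments.
Unset Strict Implicit.
Unset Printing Implicit Defensive.

Local Open Scope classical_set_scope.
Local Open Scope ring_scope.

(* Gamma(x + n) / Gamma(x + 1 - n), read for every real x as the polynomial
   (x - n + 1)(x - n + 2) ... (x + n - 1) with 2n - 1 factors (n >= 1). *)
Definition gamma_quot (R : realType) (n : nat) (x : R) : R :=
  \prod_(1 <= i < n.*2) (x - n%:R + i%:R).

Lemma gamma_quotE (R : realType) (n : nat) (x : R) : (0 < n)%N ->
  gamma_quot n x = x * \prod_(1 <= j < n) (x ^+ 2 - j%:R ^+ 2).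
Proof.
case: n => // n _; elim: n => [|n IHn].
  by rewrite /gamma_quot big_nat1 big_geq // mulr1 subrK.
rewrite big_nat_recr //= mulrA -IHn /gamma_quot.
rewrite !doubleS big_nat_recr //= big_ltn // big_add1 /=.
have -> : \prod_(1 <= i < n.*2.+2) (x - n.+2%:R + i.+1%:R) =
    \prod_(1 <= i < n.*2.+2) (x - n.+1%:R + i%:R).
  by apply: eq_bigr => i _; rewrite -(natr1 n.+1) -(natr1 i); ring.
have -> : n.*2.+3%:R = 2 * n%:R + 3 :> R.
  by rewrite -addn3 natrD -muln2 natrM mulrC.
rewrite -(natr1 n.+1) -(natr1 n); ring.
Qed.

Definition Lambda_exponent (R : realType) (x : R) (n k : nat) : R :=
  (-1) ^+ (n + k) / ((n - k)`!%:R * (k + n - 1)`!%:R)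
  * ((2 * k%:R - 1) / (2 * n%:R - 1)) * gamma_quot n x.

Definition Lambda_factor (R : realType) (x : R) (n : nat) : R :=
  \prod_(1 <= k < n.+1) k%:R `^ Lambda_exponent x n k.

Lemma Lambda_factor_gt0 (R : realType) (x : R) (n : nat) :
  0 < Lambda_factor x n.
Proof.
rewrite /Lambda_factor big_nat; apply: prodr_gt0 => k /andP[k0 _].
by rewrite powR_gt0 // ltr0n.
Qed.

Definition partial_prod (R : realType) (u : R^nat) : R^nat :=
  fun M => \prod_(1 <= n < M.+1) u n.

(* Convergence of an infinite product excludes the limit 0; for positive
   factors this is convergence of the series of logarithms, see
   [prod_convergesP]. *)
Definition prod_converges (R : realType) (u : R^nat) : Prop :=
  cvgn (partial_prod u) /\ limn (partial_prod u) != 0.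

Lemma prod_convergesP (R : realType) (u : R^nat) : (forall n, 0 < u n) ->
  prod_converges u <-> cvgn (fun M => \sum_(1 <= n < M.+1) ln (u n)).
Proof.
move=> u0.
have p0 M : 0 < partial_prod u M by exact: prodr_gt0.
have lnE M : ln (partial_prod u M) = \sum_(1 <= n < M.+1) ln (u n).
  elim: M => [|M IHM]; first by rewrite /partial_prod !big_geq // ln1.
  rewrite {1}/partial_prod [in LHS]big_nat_recr //= [RHS]big_nat_recr //= -IHM.
  by apply: lnM; rewrite posrE ?p0.
have -> : (fun M => \sum_(1 <= n < M.+1) ln (u n)) =
    (@ln R) \o partial_prod u by apply/funext => M; rewrite /= lnE.
split=> [[cu l0]|cl].
  apply/cvg_ex; exists (ln (limn (partial_prod u))).
  apply: continuous_cvg => //; apply: continuous_ln.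
  rewrite lt_neqAle eq_sym l0 /=; apply: limr_ge => //.
  by apply: nearW => M; exact: ltW.
have ce : partial_prod u @ \oo --> expR (limn ((@ln R) \o partial_prod u)).
  rewrite [X in X @ _ --> _](_ : _ = expR \o ((@ln R) \o partial_prod u)).
    by apply: continuous_cvg => //; exact: continuous_expR.
  by apply/funext => M; rewrite /= lnK ?posrE.
by split; [exact: cvgP ce | rewrite (cvg_lim _ ce) // gt_eqF // expR_gt0].
Qed.

Definition Lambda (R : realType) (x : R) : R :=
  limn (partial_prod (Lambda_factor x)).

(* Main.v *)
Require Import Defs.
From mathcomp Require Import all_boot all_order all_algebra.
From mathcomp Require Import all_classical all_reals all_analysis.
From mathcomp Require Import ring lra zify.
Import Order.TTheory GRing.Theory Num.Theory.
Import numFieldNormedType.Exports.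

(** Write n = p + 1 and k = m + 1.  Taking logarithms, the n-th inner product
contributes [log_coef p * gamma_quot p.+1 x], so everything is about the
series of these terms, whose partial sums are [log_partial x].

Interpolation.  The series is a central interpolation series for the odd
function sending N to ln N!.  Its forward difference at x involves only the
products of the numbers y - i (i + 1) with i < p, at y = x (x + 1)
([gamma_quot_diff]); these form the Newton basis on the nodes i (i + 1), i.e.
on the values of y at x = i.  The coefficients multiplying ln (m + 1) are
dual to this basis: on the node N (N + 1) their sum is 1 if m = N and 0
otherwise ([newton_basis_biorthogonal], a telescoping sum).  Hence the
difference at N is ln (N + 1), exactly, as soon as more than N terms are
taken, and the partial sums at N are eventually equal to ln N!.  Oddness in x
gives the value at - N.

Convergence.  Since |x^2 - j^2| <= j^2 (1 + x^2 / j^2), the polynomial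
[gamma_quot p.+1 x] is O(p!^2) for fixed x ([gamma_quot_le]).  It remains to
gain more than 1 / p on the coefficient.  The coefficient is an alternating
sum of differences of binomial-like weights against ln (m + 1); a summation
by parts moves the difference to the logarithm and leaves the alternating sum
of 1 / ((p - m)! (p + m)!), decreasing in m, times m (ln (m + 1) - ln m),
which increases and stays in [0, 1] ([log_coef_abel], [log_incr_mono]).  Such
a sum is at most its largest weight 1 / p!^2 ([alternating_sum_le]), so the
terms of the series are O(1 / p^2) ([log_coef_le], [log_term_le]). *)

Set Implicit Arguments.
Unset Strict Implicit.

Local Open Scope classical_set_scope.
Local Open Scope ring_scope.

(** * The series of logarithms *)

Definition log_coef (R : realType) (p : nat) : R :=
  \sum_(0 <= m < p.+1) (-1) ^+ (p + m) / ((p - m)`!%:R * (p + m).+1`!%:R)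
    * ((2 * m%:R + 1) / (2 * p%:R + 1)) * ln m.+1%:R.

Definition log_partial (R : realType) (x : R) (M : nat) : R :=
  \sum_(0 <= p < M) log_coef R p * gamma_quot p.+1 x.

Lemma ln_Lambda_factor (R : realType) (x : R) (p : nat) :
  ln (Lambda_factor x p.+1) = log_coef R p * gamma_quot p.+1 x.
Proof.
have -> : Lambda_factor x p.+1 = expR
    (\sum_(1 <= k < p.+2) Lambda_exponent x p.+1 k * ln k%:R).
  rewrite expR_sum /Lambda_factor; apply: eq_big_nat => k /andP[k0 _].
  by rewrite -ln_powR lnK // posrE powR_gt0 // ltr0n.
rewrite expRK big_add1 /= mulr_suml; apply: eq_bigr => m _.
rewrite /Lambda_exponent addSn addnS !exprS !mulN1r opprK subSS.
rewrite addnS subn1 /= addSn [(m + p)%N]addnC.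
have -> : 2 * m.+1%:R - 1 = 2 * m%:R + 1 :> R by rewrite -natr1; ring.
have -> : 2 * p.+1%:R - 1 = 2 * p%:R + 1 :> R by rewrite -natr1; ring.
by rewrite mulrAC.
Qed.

Lemma partial_prod_Lambda (R : realType) (x : R) (M : nat) :
  partial_prod (Lambda_factor x) M = expR (log_partial x M).
Proof.
rewrite expR_sum /partial_prod big_add1 /=; apply: eq_bigr => p _.
by rewrite -ln_Lambda_factor lnK // posrE Lambda_factor_gt0.
Qed.

(** * Interpolation of the logarithm of the factorial *)

Definition newton_basis (R : realType) (p : nat) (y : R) : R :=
  \prod_(0 <= i < p) (y - i%:R * i.+1%:R).

Lemma newton_basisS (R : realType) (p : nat) (y : R) :
  newton_basis p.+1 y = newton_basis p y * (y - p%:R * p.+1%:R).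
Proof. by rewrite /newton_basis big_nat_recr. Qed.

Lemma gamma_quotS (R : realType) (p : nat) (x : R) :
  gamma_quot p.+2 x = gamma_quot p.+1 x * (x ^+ 2 - p.+1%:R ^+ 2).
Proof. by rewrite !gamma_quotE // big_nat_recr //= mulrA. Qed.

Lemma gamma_quot1 (R : realType) (x : R) : gamma_quot 1 x = x.
Proof. by rewrite gamma_quotE // big_geq // mulr1. Qed.

Lemma gamma_quotN (R : realType) (p : nat) (x : R) :
  gamma_quot p.+1 (- x) = - gamma_quot p.+1 x.
Proof. by rewrite !gamma_quotE // sqrrN mulNr. Qed.

(** With y = x (x + 1), each factor y - i (i + 1) = (x - i) (x + i + 1)
contributes two of the consecutive factors of [gamma_quot p.+1 x], all of
which are obtained except the lowest, x - p. *)
Lemma gamma_quot_newton_basis (R : realType) (p : nat) (x : R) :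
  gamma_quot p.+1 x = (x - p%:R) * newton_basis p (x * (x + 1)).
Proof.
elim: p => [|p IHp].
  by rewrite gamma_quot1 /newton_basis big_geq // subr0 mulr1.
by rewrite gamma_quotS IHp newton_basisS -natr1; ring.
Qed.

(** The consecutive products at x and x + 1 share all factors but one each,
x - p and x + p + 1, whose difference does not depend on x.  The value at
x + 1 is read off from the value at - x - 1, which has the same y = x (x + 1),
by oddness. *)
Lemma gamma_quot_diff (R : realType) (p : nat) (x : R) :
  gamma_quot p.+1 (x + 1) - gamma_quot p.+1 x =
  (2 * p%:R + 1) * newton_basis p (x * (x + 1)).
Proof.
have -> : x + 1 = - (- x - 1) by ring.
rewrite gamma_quotN !gamma_quot_newton_basis.
have -> : (- x - 1) * (- x - 1 + 1) = x * - (- x - 1) by ring.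
have -> : x * (x + 1) = x * - (- x - 1) by ring.
ring.
Qed.

Lemma newton_basis_eq0 (R : realType) (p N : nat) : (N < p)%N ->
  newton_basis p (N%:R * N.+1%:R : R) = 0.
Proof.
move=> Np; rewrite /newton_basis (big_cat_nat (n := N)) ?(ltnW Np) //=.
by rewrite [X in _ * X]big_ltn // subrr mul0r mulr0.
Qed.

Lemma newton_basis_fact (R : realType) (p N : nat) : (p <= N)%N ->
  newton_basis p (N%:R * N.+1%:R : R) * (N - p)`!%:R = (N + p)`!%:R.
Proof.
elim: p => [_|p IHp pN]; first by rewrite /newton_basis big_geq // mul1r subn0 addn0.
move: (IHp (ltnW pN)) => {IHp}; rewrite newton_basisS addnS factS natrM => <-.
rewrite -(subnKC pN) addSn; move: (N - p.+1)%N => i.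
have -> : ((p + i).+1 - p.+1 = i)%N by lia.
have -> : ((p + i).+1 - p = i.+1)%N by lia.
rewrite factS natrM.
by rewrite -?natr1 ?natrD -?natr1 ?natrD; ring.
Qed.

Lemma natr_fact_neq0 (R : realType) (n : nat) : n`!%:R != 0 :> R.
Proof. by rewrite pnatr_eq0 -lt0n fact_gt0. Qed.

(** Closed form for the partial sums of the dual pairing.  The step from j to
j + 1 is the identity
m (m + 1) + (j + 1) (2 m + j + 2) = (m + j + 1) (m + j + 2),
which turns the factor of y on the left into the next basis factor. *)
Lemma newton_basis_sum (R : realType) (m j : nat) (y : R) :
  (y - m%:R * m.+1%:R) * \sum_(0 <= i < j.+1)
     (-1) ^+ i / (i`!%:R * (m + m + i).+1`!%:R) * newton_basis (m + i) y =
  (-1) ^+ j / (j`!%:R * (m + m + j).+1`!%:R) * newton_basis (m + j).+1 y.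
Proof.
elim: j => [|j IHj].
  by rewrite big_nat1 !addn0 newton_basisS; ring.
rewrite big_nat_recr // [LHS]/= mulrDr IHj.
rewrite !addnS (newton_basisS (m + j).+1) exprS.
rewrite (factS (m + m + j).+1) (factS j).
have f1 := natr_fact_neq0 R j; have f2 := natr_fact_neq0 R (m + m + j).+1.
have n1 : j.+1%:R != 0 :> R by rewrite pnatr_eq0.
have n2 : (m + m + j).+2%:R != 0 :> R by rewrite pnatr_eq0.
move: (j`!) (_.+1`!) f1 f2 n1 n2 => a b f1 f2; rewrite !natrM.
rewrite -?natr1 ?natrD -?natr1 ?natrD => n1 n2.
by field; rewrite ?f1 ?f2 ?n1 ?n2.
Qed.

(** Off the diagonal the closed form of the partial sums ends with a basis
element that vanishes at the node, and the prefactor in [newton_basis_sum]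
can be cancelled.  On the diagonal this prefactor is zero, but all terms
beyond p = m vanish and the first one is evaluated directly. *)
Lemma newton_basis_biorthogonal (R : realType) (m N M : nat) :
  (m < M)%N -> (N < M)%N ->
  \sum_(m <= p < M) (-1) ^+ (p + m) * (2 * m%:R + 1) /
    ((p - m)`!%:R * (p + m).+1`!%:R) * newton_basis p (N%:R * N.+1%:R : R) =
  (m == N)%:R.
Proof.
move=> mM NM; rewrite -{1}[m]add0n big_addn.
have [j Mj] : exists j, (M - m = j.+1)%N by exists (M - m).-1; lia.
rewrite Mj (eq_bigr (fun i => (2 * m%:R + 1) *
   ((-1) ^+ i / (i`!%:R * (m + m + i).+1`!%:R) *
    newton_basis (m + i) (N%:R * N.+1%:R : R)))); last first.
  move=> i _; rewrite addnK -addnA exprD addnn.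
  rewrite -[(-1) ^+ m.*2]signr_odd odd_double mulr1.
  by rewrite -addnn [(i + (m + m))%N]addnC [(i + m)%N]addnC; ring.
rewrite -mulr_sumr; have [->|mN] := eqVneq m N.
  (* m = N: only the term i = 0 survives *)
  rewrite big_ltn //= big_nat big1 ?addr0; last first.
    by move=> i /andP[i0 _]; rewrite newton_basis_eq0 ?mulr0 //; lia.
  rewrite !addn0 fact0 !mul1r factS natrM.
  have := @newton_basis_fact R N N (leqnn N); rewrite subnn fact0 mulr1 => ->.
  have f := natr_fact_neq0 R (N + N).
  have n1 : (N + N).+1%:R != 0 :> R by rewrite pnatr_eq0.
  move: f n1; rewrite -natr1 natrD; set a := _`!%:R => f n1.
  by field; rewrite f.
have h : N%:R * N.+1%:R - m%:R * m.+1%:R != 0 :> R.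
  by rewrite subr_eq0 -!natrM eqr_nat; apply/negP => /eqP; nia.
apply/(mulfI h); rewrite mulr0 mulrCA.
rewrite newton_basis_sum newton_basis_eq0 ?mulr0 //; lia.
Qed.

(** The factor 2 p + 1 produced by the difference cancels the denominator in
the coefficient; exchanging the sums then isolates, for each m, the pairing
of [newton_basis_biorthogonal]. *)
Lemma log_partial_diff (R : realType) (N M : nat) : (N < M)%N ->
  log_partial (N.+1%:R : R) M - log_partial N%:R M = ln N.+1%:R.
Proof.
move=> NM; rewrite /log_partial -sumrB.
transitivity (\sum_(0 <= p < M) \sum_(0 <= m < M | (m <= p)%N)
   ((-1) ^+ (p + m) * (2 * m%:R + 1) / ((p - m)`!%:R * (p + m).+1`!%:R)
     * newton_basis p (N%:R * N.+1%:R : R)) * ln m.+1%:R).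
  apply: eq_big_nat => p /andP[_ pM].
  rewrite -mulrBr -natr1 gamma_quot_diff natr1 /log_coef mulr_suml.
  rewrite (big_nat_widen _ _ M) //=; apply: eq_big => m; first by rewrite ltnS.
  move=> _; have h : 2 * p%:R + 1 != 0 :> R.
    by rewrite -natrM natr1 pnatr_eq0.
  have f1 := natr_fact_neq0 R (p - m); have f2 := natr_fact_neq0 R (p + m).+1.
  by field; rewrite h f1 f2.
rewrite (exchange_big_dep_nat xpredT) //=.
transitivity (\sum_(0 <= m < M) (m == N)%:R * ln m.+1%:R : R).
  apply: eq_big_nat => m /andP[_ mM].
  rewrite -(@newton_basis_biorthogonal R m N M mM NM) mulr_suml.
  by rewrite (big_nat_widenl m 0).
rewrite big_mkord (bigD1 (Ordinal NM)) //= eqxx mul1r big1 ?addr0 // => i iN.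
by rewrite (_ : (i == N :> nat) = false) ?mul0r //; apply/negbTE.
Qed.

Lemma log_partial0 (R : realType) (M : nat) : log_partial (0 : R) M = 0.
Proof.
by rewrite /log_partial big1 // => p _; rewrite gamma_quotE // mul0r mulr0.
Qed.

Lemma log_partialN (R : realType) (x : R) (M : nat) :
  log_partial (- x) M = - log_partial x M.
Proof.
by rewrite /log_partial -sumrN; apply: eq_bigr => p _; rewrite gamma_quotN mulrN.
Qed.

Lemma log_partial_nat (R : realType) (N M : nat) : (N <= M)%N ->
  log_partial (N%:R : R) M = ln N`!%:R.
Proof.
elim: N => [_|N IHN NM]; first by rewrite log_partial0 fact0 ln1.
rewrite -[LHS](subrK (log_partial (N%:R : R) M)) log_partial_diff //.
by rewrite IHN 1?ltnW // factS natrM lnM // posrE ltr0n ?fact_gt0.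
Qed.

(** * Alternating sums with monotone weights *)

(** Plain monotonicity of the products d m * u m fails, so the
alternating-series bound does not apply directly.  With the sign of the last
term factored out, the partial sums satisfy the two-sided bound
- (d 0 - d j) u j <= s <= d 0 u j, which is preserved by s |-> d u - s. *)
Lemma alternating_sum_le (R : realType) (d u : nat -> R) (p : nat) :
  (forall m, (m <= p)%N -> 0 <= d m) -> (forall m, 0 <= u m) ->
  (forall m, (m < p)%N -> d m.+1 <= d m) -> (forall m, u m <= u m.+1) ->
  `|\sum_(0 <= m < p.+1) (-1) ^+ m * (d m * u m)| <= d 0%N * u p.
Proof.
move=> d0 u0 dd ud.
have d_le j : (j <= p)%N -> d j <= d 0%N.
  elim: j => // j IHj jp; apply: (le_trans (dd j jp)).
  exact: IHj (ltnW jp).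
suff H j : (j <= p)%N -> let s := (-1) ^+ j *
    \sum_(0 <= m < j.+1) (-1) ^+ m * (d m * u m) in
    - ((d 0%N - d j) * u j) <= s /\ s <= d 0%N * u j.
  have [h1 h2] := H p (leqnn p).
  rewrite -[X in X <= _](normrMsign p) ler_norml h2 andbT.
  rewrite (le_trans _ h1) // lerN2.
  by rewrite ler_wpM2r // gerBl d0.
elim: j => [_|j IHj jp] /=.
  by rewrite big_nat1 !expr0 !mul1r subrr mul0r oppr0 lexx mulr_ge0 ?d0.
have {IHj} [] := IHj (ltnW jp); rewrite (big_nat_recr j.+1) //.
set s := \sum_(0 <= m < j.+1) _ => h1 h2.
rewrite /= mulrDr mulrA -expr2 sqrr_sign mul1r exprS mulN1r mulNr.
move: h1 h2; set t := _ * s => h1 h2.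
have ? := d0 j (ltnW jp); have ? := d0 j.+1 jp; have := dd j jp.
have ? := u0 j; have := ud j.
have := d_le j.+1 jp.
move=> a b c; split; nra.
Qed.

(** * Decay of the coefficients *)

Definition log_incr (R : realType) (m : nat) : R :=
  m%:R * (ln m.+1%:R - ln m%:R).

Lemma log_incr_ge0 (R : realType) (m : nat) : 0 <= log_incr R m.
Proof.
case: m => [|m]; first by rewrite /log_incr mul0r.
by rewrite /log_incr mulr_ge0 // subr_ge0 ler_ln ?posrE ?ltr0n // ler_nat.
Qed.

Lemma ln_sub_le (R : realType) (a b : R) : 0 < a -> 0 < b ->
  ln a - ln b <= a / b - 1.
Proof.
move=> a0 b0; rewrite -ln_div ?posrE //.
rewrite [in X in X <= _](_ : a / b = 1 + (a / b - 1)); last by ring.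
by apply: le_ln1Dx; rewrite ltrBrDr addNr divr_gt0.
Qed.

Lemma log_incr_le1 (R : realType) (m : nat) : log_incr R m <= 1.
Proof.
case: m => [|m]; first by rewrite /log_incr mul0r.
have m0 : (0 : R) < m.+1%:R by rewrite ltr0n.
have := @ln_sub_le R m.+2%:R m.+1%:R (ltr0Sn _ _) m0.
rewrite -(ler_pM2l m0) => h; apply: le_trans h _.
by rewrite -(natr1 m.+1) le_eqVlt; apply/orP; left; apply/eqP; field; rewrite gt_eqF.
Qed.

(** This says that (1 + 1/m)^m increases with m.  It is the concavity of ln at
c = (m + 2) / (m + 1), the weighted mean of (m + 1) / m (weight m) and 1
(weight 1): adding the tangent inequalities at these two points with their
weights, the linear terms cancel. *)
Lemma log_incr_mono (R : realType) (m : nat) : log_incr R m <= log_incr R m.+1.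
Proof.
case: m => [|m]; first by rewrite {1}/log_incr mul0r log_incr_ge0.
have n0 k : (0 : R) < k.+1%:R by rewrite ltr0n.
have h1 := @ln_sub_le R (m.+2%:R / m.+1%:R) (m.+3%:R / m.+2%:R)
  (divr_gt0 (n0 _) (n0 _)) (divr_gt0 (n0 _) (n0 _)).
have h2 := @ln_sub_le R m.+2%:R m.+3%:R (n0 _) (n0 _).
rewrite !ln_div ?posrE // in h1; rewrite /log_incr.
move: (n0 m.+1) (n0 m.+2) h1 h2 (n0 m) => {n0}.
set l1 := ln _; set l2 := ln _; set l3 := ln _.
rewrite -(natr1 m.+2) -(natr1 m.+1); move: (m.+1%:R : R) => t t1 t2 h1 h2 t0.
have h1' : t * (l1 - l2 - (l3 - l1)) <= (t + 1 + 1)^-1.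
  move: h1; rewrite -(ler_pM2l t0) => h1; apply: le_trans h1 _.
  by rewrite le_eqVlt; apply/orP; left; apply/eqP; field; rewrite !gt_eqF.
have h2' : l1 - l3 <= - (t + 1 + 1)^-1.
  apply: le_trans h2 _.
  by rewrite le_eqVlt; apply/orP; left; apply/eqP; field; rewrite !gt_eqF.
lra.
Qed.

(** Summation by parts.  With b m = 1 / ((p - m)! (p + m)!), the weight of
ln (m + 1) in the coefficient, multiplied by p (2 p + 1), equals
m b m + (m + 1) b (m + 1) up to an alternating sign, so regrouping the terms
around b m leaves m b m (ln (m + 1) - ln m). *)
Lemma log_coef_abel (R : realType) (p : nat) :
  p%:R * (2 * p%:R + 1) * log_coef R p = (-1) ^+ p *
  \sum_(0 <= m < p.+1) (-1) ^+ m *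
    (((p - m)`!%:R * (p + m)`!%:R)^-1 * log_incr R m).
Proof.
set b := fun m : nat => ((p - m)`!%:R * (p + m)`!%:R)^-1 : R.
set a := fun m : nat => ((p - m)`!%:R * (p + m).+1`!%:R)^-1 : R.
have -> : p%:R * (2 * p%:R + 1) * log_coef R p = (-1) ^+ p *
    \sum_(0 <= m < p.+1) (-1) ^+ m * (p%:R * (2 * m%:R + 1) * a m) * ln m.+1%:R.
  rewrite !mulr_sumr; apply: eq_bigr => m _; rewrite exprD /a.
  have h : 2 * p%:R + 1 != 0 :> R by rewrite -natrM natr1 pnatr_eq0.
  have f1 := natr_fact_neq0 R (p - m); have f2 := natr_fact_neq0 R (p + m).+1.
  by field; rewrite h f1 f2.
congr (_ * _).
(* The truncated subtraction p - m breaks the splitting of the weight at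
   m = p, so the regrouping stops before that term, which then cancels the
   boundary term on the right. *)
suff H j : (j <= p)%N ->
    \sum_(0 <= m < j) (-1) ^+ m * (p%:R * (2 * m%:R + 1) * a m) * ln m.+1%:R =
    \sum_(0 <= m < j.+1) (-1) ^+ m * (b m * log_incr R m)
      - (-1) ^+ j * (j%:R * b j) * ln j.+1%:R :> R.
  rewrite big_nat_recr //= H // /a /b subnn fact0 !mul1r factS natrM.
  have f := natr_fact_neq0 R (p + p).
  have n1 : (p + p).+1%:R != 0 :> R by rewrite pnatr_eq0.
  rewrite -[RHS]addr0 -[LHS]addrA; congr (_ + _).
  move: f n1; rewrite -natr1 natrD; set c := _`!%:R => f n1.
  by field; rewrite f.
elim: j => [_|j IHj jp].
  by rewrite big_geq // big_nat1 /log_incr !mul0r !mulr0 mul0r subrr.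
have step : p%:R * (2 * j%:R + 1) * a j = j%:R * b j + j.+1%:R * b j.+1.
  rewrite /a /b -(subnKC jp) addSn; move: (p - j.+1)%N => i.
  have -> : ((j + i).+1 - j.+1 = i)%N by lia.
  have -> : ((j + i).+1 - j = i.+1)%N by lia.
  rewrite !addSn addnS (factS i) (factS (j + i + j).+1).
  have f1 := natr_fact_neq0 R i; have f2 := natr_fact_neq0 R (j + i + j).+1.
  have n1 : i.+1%:R != 0 :> R by rewrite pnatr_eq0.
  have n2 : (j + i + j).+2%:R != 0 :> R by rewrite pnatr_eq0.
  move: (i`!) (_.+1`!) f1 f2 n1 n2 => x y f1 f2; rewrite !natrM.
  rewrite -?natr1 ?natrD -?natr1 ?natrD => n1 n2.
  by field; rewrite ?f1 ?f2 ?n1 ?n2.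
rewrite big_nat_recr //= IHj 1?ltnW // step [in RHS]big_nat_recr //=.
by rewrite /log_incr exprS; ring.
Qed.

Lemma log_coef_le (R : realType) (p : nat) :
  p%:R * (2 * p%:R + 1) * (p`!%:R ^+ 2 * `|log_coef R p|) <= 1.
Proof.
have f n : (0 : R) < n`!%:R by rewrite ltr0n fact_gt0.
have h : p%:R * (2 * p%:R + 1) * `|log_coef R p| <= (p`!%:R ^+ 2)^-1.
  rewrite -[X in X * _]ger0_norm ?mulr_ge0 ?addr_ge0 ?mulr_ge0 // -normrM.
  rewrite log_coef_abel normrM -signr_odd normr_sign mul1r.
  apply: (le_trans (@alternating_sum_le R
    (fun m => ((p - m)`!%:R * (p + m)`!%:R)^-1) _ p _ _ _ _)).
  - by move=> m _; rewrite invr_ge0 mulr_ge0.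
  - exact: log_incr_ge0.
  - move=> m mp; rewrite lef_pV2 ?posrE ?mulr_gt0 // -!natrM ler_nat.
    rewrite addnS (factS (p + m)) -(subnSK mp) factS -mulnA [leqRHS]mulnCA.
    by rewrite leq_mul2r; apply/orP; right; lia.
  - exact: log_incr_mono.
  by rewrite subn0 addn0 -expr2 -[X in _ <= X]mulr1 ler_wpM2l ?log_incr_le1.
rewrite mulrCA; move: h; rewrite -(ler_pM2l (exprn_gt0 2 (f p))).
by rewrite mulfV // gt_eqF // exprn_gt0.
Qed.

(** * Convergence *)

(** The product of the factors 1 + x^2 / j^2 is at most exp of the sum of
x^2 / j^2.  Since 1 / j^2 <= 2 (1 / j - 1 / (j + 1)), that sum is dominated
by a telescoping one, which is the exponent here. *)
Lemma gamma_quot_le (R : realType) (p : nat) (x : R) :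
  `|gamma_quot p.+1 x| <=
  p`!%:R ^+ 2 * (`|x| * expR (2 * x ^+ 2 * (1 - p.+1%:R^-1))).
Proof.
elim: p => [|p IHp].
  by rewrite gamma_quot1 fact0 invr1 subrr mulr0 expR0 mulr1 expr1n mul1r.
rewrite gamma_quotS normrM factS natrM.
have q0 : (0 : R) < p.+1%:R by rewrite ltr0n.
have h : `|x ^+ 2 - p.+1%:R ^+ 2| <=
   p.+1%:R ^+ 2 * expR (2 * x ^+ 2 * (p.+1%:R^-1 - p.+2%:R^-1)).
  have x0 := sqr_ge0 x; apply: (@le_trans _ _ (x ^+ 2 + p.+1%:R ^+ 2)).
    by rewrite ler_norml; have := sqr_ge0 (p.+1%:R : R); lra.
  have -> : x ^+ 2 + p.+1%:R ^+ 2 = p.+1%:R ^+ 2 * (1 + x ^+ 2 / p.+1%:R ^+ 2) :> R.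
    by field; rewrite gt_eqF.
  rewrite ler_pM2l ?exprn_gt0 //; apply: le_trans (expR_ge1Dx _); rewrite lerD2l.
  rewrite [2 * _]mulrC -[leRHS]mulrA; apply: ler_wpM2l => //.
  have q1 : (1 : R) <= p.+1%:R by rewrite ler1n.
  rewrite -(natr1 p.+1); move: (p.+1%:R : R) q0 q1 => t t0 t1.
  rewrite -subr_ge0.
  have -> : 2 * (t^-1 - (t + 1)^-1) - (t ^+ 2)^-1 = (t - 1) / (t ^+ 2 * (t + 1)).
    by field; rewrite !gt_eqF //; lra.
  by rewrite divr_ge0 ?subr_ge0 // mulr_ge0 ?exprn_ge0 //; lra.
apply: le_trans (ler_pM (normr_ge0 _) (normr_ge0 _) IHp h) _.
rewrite [X in _ <= X](_ : _ = p.+1%:R ^+ 2 * p`!%:R ^+ 2 * (`|x| *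
  (expR (2 * x ^+ 2 * (1 - p.+1%:R^-1)) *
   expR (2 * x ^+ 2 * (p.+1%:R^-1 - p.+2%:R^-1))))).
  by rewrite le_eqVlt; apply/orP; left; apply/eqP; ring.
rewrite -expRD -mulrDr exprMn; congr (_ * (_ * expR (_ * _))); ring.
Qed.

Lemma log_term_le (R : realType) (x : R) (p : nat) :
  `|log_coef R p * gamma_quot p.+1 x| <=
  2 * `|x| * expR (2 * x ^+ 2) * (p.+1%:R^-1 - p.+2%:R^-1).
Proof.
have f : (0 : R) < p`!%:R ^+ 2 by rewrite exprn_gt0 // ltr0n fact_gt0.
have E : `|gamma_quot p.+1 x| <= p`!%:R ^+ 2 * (`|x| * expR (2 * x ^+ 2)).
  apply: le_trans (gamma_quot_le p x) _; rewrite ler_pM2l //.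
  apply: ler_wpM2l => //; rewrite ler_expR -[X in _ <= X]mulr1.
  by apply: ler_wpM2l; [rewrite mulr_ge0 ?sqr_ge0 | rewrite gerBl invr_ge0].
have C : p`!%:R ^+ 2 * `|log_coef R p| <= 2 * (p.+1%:R^-1 - p.+2%:R^-1).
  (* For p = 0 the coefficient is ln 1 = 0.  For p >= 1, the constant 2 is the
     least that gives 1 / (p (2 p + 1)) <= 2 / ((p + 1) (p + 2)), with equality
     at p = 1. *)
  have [->|p0] := posnP p.
    rewrite /log_coef big_nat1 ln1 mulr0 normr0 mulr0.
    by rewrite mulr_ge0 // subr_ge0 lef_pV2 ?posrE ?ltr0n // ler_nat.
  have := log_coef_le R p; set c := _ ^+ 2 * _.
  have : (1 : R) <= p%:R by rewrite ler1n.
  rewrite -(natr1 p.+1) -(natr1 p); move: (p%:R : R) => t t1.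
  have k0 : 0 < t * (2 * t + 1) by nra.
  move=> h; rewrite -(ler_pM2l k0); apply: le_trans h _; rewrite -subr_ge0.
  have -> : t * (2 * t + 1) * (2 * ((t + 1)^-1 - (t + 1 + 1)^-1)) - 1 =
     (3 * t + 2) * (t - 1) / ((t + 1) * (t + 1 + 1)).
    by field; rewrite !gt_eqF //; lra.
  by rewrite divr_ge0 ?mulr_ge0 //; lra.
rewrite normrM; apply: le_trans (ler_wpM2l (normr_ge0 _) E) _.
rewrite mulrCA mulrA.
rewrite [X in _ <= X](_ : _ = 2 * (p.+1%:R^-1 - p.+2%:R^-1) *
  (`|x| * expR (2 * x ^+ 2))).
  by apply: ler_wpM2r => //; rewrite mulr_ge0 ?expR_ge0.
ring.
Qed.

Lemma is_cvg_log_partial (R : realType) (x : R) : cvgn (log_partial x).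
Proof.
apply: (@normed_cvg R R^o (fun p => log_coef R p * gamma_quot p.+1 x)).
set C := 2 * `|x| * expR (2 * x ^+ 2).
have C0 : 0 <= C by rewrite !mulr_ge0 ?expR_ge0.
apply: (@series_le_cvg _ _ (fun p => C * (p.+1%:R^-1 - p.+2%:R^-1))).
- by move=> p /=.
- by move=> p; exact: le_trans (normr_ge0 _) (log_term_le x p).
- exact: log_term_le.
have -> : series (fun p => C * (p.+1%:R^-1 - p.+2%:R^-1)) =
    (fun M => C * (1 - M.+1%:R^-1)).
  apply/funext => M; rewrite seriesEnat /=; elim: M => [|M IHM].
    by rewrite big_geq // invr1 subrr mulr0.
  by rewrite big_nat_recr //= IHM; ring.
apply: is_cvgM; first exact: is_cvg_cst.
apply: is_cvgB; first exact: is_cvg_cst.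
exact: (cvgP _ (@cvg_harmonic R)).
Qed.

Lemma Lambda_eq (R : realType) (x c : R) (N : nat) :
  (forall M, (N <= M)%N -> log_partial x M = c) -> Lambda x = expR c.
Proof.
move=> h; apply/cvg_lim => //; apply: cvg_near_cst; exists N => // M /= NM.
by rewrite partial_prod_Lambda h.
Qed.

Theorem theorem2p10 (R : realType) :
  (forall x : R, prod_converges (Lambda_factor x)) /\
  (forall N : nat, (0 < N)%N ->
     Lambda (N%:R : R) = N`!%:R /\ Lambda (- N%:R : R) = (N`!%:R)^-1).
Proof.
split=> [x|N _].
  apply/prod_convergesP; first exact: Lambda_factor_gt0.
  rewrite [X in cvgn X](_ : _ = log_partial x); first exact: is_cvg_log_partial.
  apply/funext => M; rewrite big_add1 /=; apply: eq_bigr => p _.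
  exact: ln_Lambda_factor.
have f0 : (N`!%:R : R) \is Num.pos by rewrite posrE ltr0n fact_gt0.
have h M : (N <= M)%N -> log_partial (N%:R : R) M = ln N`!%:R.
  exact: log_partial_nat.
split; first by rewrite (@Lambda_eq _ _ _ N h) lnK.
rewrite (@Lambda_eq _ _ (- ln N`!%:R) N) ?expRN ?lnK // => M NM.
by rewrite log_partialN h.
Qed.
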